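(* Let $1<q<p<\infty$. Let $X$ be an infinite dimensional $q$-AUC Banach space and let $Y$ be a $p$-AUS and quasi-reflexive Banach space. Then $$\alpha_Y(X)\le\frac qp.$$
   Context: For a map $f:X\to Y$ between Banach spaces, put $\rho_f(t)=\inf\{\|f(x)-f(y)\|:\ \|x-y\|\ge t\}$ and $\omega_f(t)=\sup\{\|f(x)-f(y)\|:\ \|x-y\|\le t\}$. The map $f$ is a coarse embedding if $\lim_{t\to\infty}\rho_f(t)=\infty$ and $\omega_f(t)<\infty$ for all $t>0$. The compression exponent $\alpha_Y(X)$ is the supremum of all $\alpha\in[0,1)$ for which there exist a coarse embedding $f:X\to Y$ and $A,C\in(0,\infty)$ with $\rho_f(t)\ge At^\alpha-C$ for all $t>0$ (with $\alpha_Y(X)=0$ if there is no such $\alpha$). A Banach space $Y$ is quasi-reflexive if the image of its canonical embedding into $Y^{**}$ has finite codimension in $Y^{**}$. For a Banach space $X$ with unit sphere $S_X$, $t\in[0,\infty)$, $x\in S_X$ and $Z$ a closed linear subspace of $X$, put $\overline{\rho}_X(t,x,Z)=\sup_{z\in S_Z}(\|x+tz\|-1)$ (with value $0$ if $Z=\{0\}$) and $\overline{\delta}_X(t,x,Z)=\inf_{z\in S_Z}(\|x+tz\|-1)$. Put $\overline{\rho}_X(t,x)=\inf_{\dim(X/Z)<\infty}\overline{\rho}_X(t,x,Z)$, $\overline{\delta}_X(t,x)=\sup_{\dim(X/Z)<\infty}\overline{\delta}_X(t,x,Z)$, $\overline{\rho}_X(t)=\sup_{x\in S_X}\overline{\rho}_X(t,x)$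 and $\overline{\delta}_X(t)=\inf_{x\in S_X}\overline{\delta}_X(t,x)$. $X$ is $p$-AUS if there exists $c>0$ such that $\overline{\rho}_X(t)\le ct^p$ for all $t\in[0,\infty)$; $X$ is $q$-AUC if there exists $c>0$ such that $\overline{\delta}_X(t)\ge ct^q$ for all $t\in[0,1]$. *)

(* Defs.v *)
From HB Require Import structures.
From mathcomp Require Import all_boot all_order all_algebra.
From mathcomp Require Import all_classical all_reals all_analysis.

Set Implicit Arguments.
Unset Strict Implicit.
Unset Printing Implicit Defensive.

Import Order.TTheory GRing.Theory Num.Theory.
Import numFieldNormedType.Exports.

Local Open Scope classical_set_scope.
Local Open Scope ring_scope.

Section FiniteCodimension.
Context {R : fieldType} {V : lmodType R}.

Definition linear_span (n : nat) (e : 'I_n -> V) : set V :=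
  [set \sum_(i < n) a i *: e i | a in [set: 'I_n -> R]].

Definition finite_dim_space : Prop :=
  exists (n : nat) (e : 'I_n -> V), [set: V] `<=` linear_span e.

Definition linear_subspace (Z : set V) : Prop := submod_closed (mem Z).

(* For a linear subspace Z, the classes of e_1, ..., e_n span V / Z, that is,
   V = span(e_1, ..., e_n) + Z. *)
Definition finite_codim (Z : set V) : Prop :=
  exists (n : nat) (e : 'I_n -> V),
    forall v, exists2 u, linear_span e u & Z (v - u).

End FiniteCodimension.
Arguments finite_dim_space {R} V.

Section Dual.
Context {R : realType} {V : normedModType R}.

Definition dual_pred : {pred V -> R^o} :=
  fun f => `[< linear f /\ continuous f >].

Lemma dual_pred_submod : submod_closed dual_pred.
Proof.
split.
  apply/asboolP; split; first by move=> a u v /=; rewrite scaler0 addr0.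
  by move=> x; exact: cvg_cst.
move=> a f g /asboolP[lf cf] /asboolP[lg cg]; apply/asboolP; split.
  move=> b u v; rewrite /= [LHS]/GRing.add /= /GRing.scale /=.
  have -> : f (b *: u + v) = b *: f u + f v by exact: lf.
  have -> : g (b *: u + v) = b *: g u + g v by exact: lg.
  rewrite !fctE /=.
  by rewrite /GRing.scale /= !mulrDr addrACA !mulrA (mulrC a b).
move=> x; apply: cvgD; last exact: cg.
by apply: cvgZl_tmp; exact: cf.
Qed.

HB.instance Definition _ :=
  GRing.isSubmodClosed.Build R (V -> R^o) dual_pred dual_pred_submod.

End Dual.

(* The topological dual of V; the norm is the operator norm. *)
Record dual_space (R : realType) (V : normedModType R) := DualSpace {
  dual_fun :> V -> R^o ;
  dual_funP : dual_fun \in dual_pred }.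

HB.instance Definition _ (R : realType) (V : normedModType R) :=
  [isSub for @dual_fun R V].
HB.instance Definition _ (R : realType) (V : normedModType R) :=
  [Choice of dual_space V by <:].
HB.instance Definition _ (R : realType) (V : normedModType R) :=
  [SubChoice_isSubLmodule of dual_space V by <:].

Section DualNorm.
Context {R : realType} {V : normedModType R}.
Implicit Types (f g : dual_space V) (x : V).

Lemma dual_linear f : linear f.
Proof. by have /asboolP[] := dual_funP f. Qed.

Lemma dual_continuous f : continuous f.
Proof. by have /asboolP[] := dual_funP f. Qed.

HB.instance Definition _ f :=
  GRing.isLinear.Build R V R^o *:%R (dual_fun f) (dual_linear f).

Definition dual_norm f : R := sup [set `|f x| | x in [set x | `|x| <= 1]].

Lemma dual_norm_has_sup f : has_sup [set `|f x| | x in [set x | `|x| <= 1]].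
Proof.
split; first by exists `|f 0|; exists 0 => //=; rewrite normr0.
have /bounded_funP/(_ 1)[M fM] : bounded_near (f : {linear V -> R^o}) (nbhs (0 : V)).
  by apply/linear_bounded_continuous; exact: dual_continuous.
by exists M => _ [x /= x1 <-]; exact: fM.
Qed.

Lemma dual_norm_ub1 f x : `|x| <= 1 -> `|f x| <= dual_norm f.
Proof.
move=> x1; apply: sup_upper_bound; first exact: dual_norm_has_sup.
by exists x.
Qed.

Lemma dual_norm_ge0 f : 0 <= dual_norm f.
Proof. by apply: le_trans (dual_norm_ub1 f (_ : `|0| <= 1)); rewrite ?normr0. Qed.

Lemma dual_norm_le f (M : R) :
  (forall x, `|x| <= 1 -> `|f x| <= M) -> dual_norm f <= M.
Proof.
move=> fM; apply: ge_sup; first by have [] := dual_norm_has_sup f.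
by move=> _ [x /= x1 <-]; exact: fM.
Qed.

Lemma dual_norm_ub f x : `|f x| <= dual_norm f * `|x|.
Proof.
have [->|x0] := eqVneq x 0; first by rewrite linear0 !normr0 mulr0.
have nx : 0 < `|x| by rewrite normr_gt0.
rewrite -ler_pdivrMr// mulrC -[`|x|^-1]gtr0_norm ?invr_gt0// -normrM.
rewrite -[_ * _]/(`|x|^-1 *: f x) -linearZ; apply: dual_norm_ub1.
by rewrite normrZ normfV normr_id mulVf// gt_eqF.
Qed.

Lemma dual_normD f g : dual_norm (f + g) <= dual_norm f + dual_norm g.
Proof.
apply: dual_norm_le => x x1.
rewrite (_ : (f + g) x = f x + g x)//.
by rewrite (le_trans (ler_normD _ _))// lerD// dual_norm_ub1.
Qed.

Lemma dual_normZ (a : R) f : dual_norm (a *: f) = `|a| * dual_norm f.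
Proof.
have le b h : dual_norm (b *: h) <= `|b| * dual_norm h.
  apply: dual_norm_le => x x1; rewrite (_ : (b *: h) x = b * h x)//.
  by rewrite normrM ler_wpM2l// dual_norm_ub1.
apply/eqP; rewrite eq_le le /=.
have [->|a0] := eqVneq a 0; first by rewrite normr0 mul0r dual_norm_ge0.
rewrite -ler_pdivlMl ?normr_gt0// -normfV.
by apply: le_trans (le _ _); rewrite scalerA mulVf// scale1r.
Qed.

Lemma dual_norm0_eq0 f : dual_norm f = 0 -> f = 0.
Proof.
move=> f0; apply/val_inj/funext => x /=.
by apply/normr0_eq0/eqP; rewrite eq_le normr_ge0 andbT (le_trans (dual_norm_ub f x))// f0 mul0r.
Qed.

HB.instance Definition _ := Lmodule_isNormed.Build R (dual_space V)
  dual_normD dual_normZ dual_norm0_eq0.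

End DualNorm.

Section QuasiReflexive.
Context {R : realType} {V : normedModType R}.

Definition evaluation (x : V) : dual_space V -> R^o := fun f => f x.

Lemma evaluation_dual (x : V) : evaluation x \in dual_pred.
Proof.
have lx : linear (evaluation x) by [].
apply/asboolP; split => //.
pose ev : {linear dual_space V -> R^o} :=
  HB.pack (evaluation x) (GRing.isLinear.Build _ _ _ _ _ lx).
apply: (linear_bounded_continuous ev).1; apply/bounded_funP => r.
exists (r * `|x|) => f fr; apply: le_trans (dual_norm_ub f x) _.
exact: ler_wpM2r.
Qed.

Definition bidual_embedding (x : V) : dual_space (dual_space V) :=
  DualSpace (evaluation_dual x).

End QuasiReflexive.

Definition quasi_reflexive (R : realType) (Y : normedModType R) : Prop :=
  finite_codim (range (@bidual_embedding R Y)).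

Section AsymptoticModuli.
Context {R : realType} {X : normedModType R}.
Implicit Types (t p q : R) (x : X) (Z : set X).
Local Open Scope ereal_scope.

Definition sphere Z : set X := [set z | Z z /\ `|z|%R = 1%R].

Definition cofinite_subspace : set (set X) :=
  [set Z | [/\ linear_subspace Z, closed Z & finite_codim Z]].

(* The aus_/auc_ moduli are usually written \overline{rho}_X and
   \overline{delta}_X; the supremum over the empty sphere of the zero subspace
   is set to 0 by convention. *)
Definition aus_modulus_at_in t x Z : \bar R :=
  if Z == [set 0%R] then 0
  else ereal_sup [set (`|x + t *: z| - 1)%:E | z in sphere Z].

Definition auc_modulus_at_in t x Z : \bar R :=
  ereal_inf [set (`|x + t *: z| - 1)%:E | z in sphere Z].

Definition aus_modulus_at t x : \bar R :=
  ereal_inf [set aus_modulus_at_in t x Z | Z in cofinite_subspace].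

Definition auc_modulus_at t x : \bar R :=
  ereal_sup [set auc_modulus_at_in t x Z | Z in cofinite_subspace].

Definition aus_modulus t : \bar R :=
  ereal_sup [set aus_modulus_at t x | x in sphere setT].

Definition auc_modulus t : \bar R :=
  ereal_inf [set auc_modulus_at t x | x in sphere setT].

End AsymptoticModuli.

Definition AUS (R : realType) (p : R) (X : normedModType R) : Prop :=
  exists2 c : R, 0 < c &
    forall t, 0 <= t -> (aus_modulus (X := X) t <= (c * t `^ p)%:E)%E.

Definition AUC (R : realType) (q : R) (X : normedModType R) : Prop :=
  exists2 c : R, 0 < c &
    forall t, 0 <= t <= 1 -> ((c * t `^ q)%:E <= auc_modulus (X := X) t)%E.

Section CoarseEmbedding.
Context {R : realType} {X Y : normedModType R}.
Implicit Types (f : X -> Y) (t : R).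

(* rho_f and omega_f *)
Definition compression_modulus f t : \bar R :=
  ereal_inf [set `|f z.1 - f z.2|%:E | z in [set z : X * X | t <= `|z.1 - z.2|]].

Definition expansion_modulus f t : \bar R :=
  ereal_sup [set `|f z.1 - f z.2|%:E | z in [set z : X * X | `|z.1 - z.2| <= t]].

Definition coarse_embedding f : Prop :=
  compression_modulus f t @[t --> +oo] --> +oo%E /\
  forall t, 0 < t -> (expansion_modulus f t < +oo)%E.

End CoarseEmbedding.

(* [sup] is the real supremum; it is 0 on the empty set. *)
Definition compression_exponent (R : realType) (X Y : normedModType R) : R :=
  sup [set alpha : R | 0 <= alpha < 1 /\
    exists f : X -> Y, coarse_embedding f /\
    exists A C : R, [/\ 0 < A, 0 < C & forall t, 0 < t ->
      ((A * t `^ alpha - C)%:E <= compression_modulus f t)%E]].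

(* Main.v *)
(* Idea.  Let f : X -> Y be a coarse embedding.  In X, the AUC condition yields
   unit vectors x_n such that every signed sum of l distinct ones has norm at
   least (c l)^(1/q); no weak nullness is needed, since x_n can be taken in a
   finite-codimensional subspace adapted to the finitely many {-1,0,1}
   combinations of its predecessors.

   Put g(n_1, ..., n_k) = f(x_{n_1} + ... + x_{n_k}).  Changing one coordinate
   moves g by at most L = omega_f(2).  Taking iterated weak-star limits in Y**
   along a free ultrafilter U writes g as a constant plus increments
   z_i(n_1, ..., n_i) of norm at most L that are weak-star null in n_i.  Since
   Y** / Y is finite-dimensional, the ball of radius L is covered modulo Y by
   finitely many small balls, the colours, and the iterated U-limits of the
   colours of the increments do not depend on the branch.  So one can choose
   n_1 < m_1 < n_2 < m_2 < ... with z_i(n) - z_i(m) almost in Y and almost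
   weakly null, and p-AUS gives |g(n) - g(m)| <= B L k^(1/p).  Comparing the two
   estimates for all k yields alpha / q <= 1 / p. *)

From HB Require Import structures.
Require Import Defs.
From mathcomp Require Import all_boot all_order all_algebra.
From mathcomp Require Import all_classical all_reals all_analysis.
From mathcomp Require Import ring lra.

Set Implicit Arguments.
Unset Strict Implicit.
Unset Printing Implicit Defensive.

Import Order.TTheory GRing.Theory Num.Theory.
Import numFieldNormedType.Exports.

Local Open Scope classical_set_scope.
Local Open Scope ring_scope.

(** * Hahn-Banach *)

Section HahnBanach.
Context {R : realType} {V : lmodType R}.
Implicit Types (p q : V -> R) (x y v : V).

Definition sublinear q : Prop :=
  (forall x y, q (x + y) <= q x + q y) /\
  (forall (a : R) x, 0 <= a -> q (a *: x) <= a * q x).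

Lemma sublinear_at0 q : sublinear q -> q 0 = 0.
Proof.
move=> [qD qZ]; apply/eqP; rewrite eq_le; apply/andP; split.
  by have := qZ 0 0 (lexx _); rewrite scale0r mul0r.
by have := qD 0 0; rewrite addr0; lra.
Qed.

Lemma sublinearN q x : sublinear q -> - q (- x) <= q x.
Proof.
move=> sq; have := sq.1 x (- x); rewrite subrr (sublinear_at0 sq); lra.
Qed.

Lemma sublinearZ q (a : R) x : sublinear q -> 0 <= a -> q (a *: x) = a * q x.
Proof.
move=> sq; rewrite le_eqVlt => /predU1P[<-|a0].
  by rewrite scale0r mul0r sublinear_at0.
apply/eqP; rewrite eq_le sq.2 ?(ltW a0)//= -ler_pdivlMl//.
have := sq.2 a^-1 (a *: x); rewrite scalerA mulVf ?gt_eqF// scale1r; apply.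
by rewrite invr_ge0 ltW.
Qed.

(** Common core of three constructions: the shift along a vector, lower bounds of chains, and the
    distance to a subspace. The minorant [b] keeps the infima finite. *)
Lemma sublinear_inf (I : Type) (A : set I) (F : I -> V -> R) (b : V -> R) :
  A !=set0 -> (forall i x, A i -> b x <= F i x) ->
  (forall i j x y, A i -> A j ->
    exists2 k, A k & F k (x + y) <= F i x + F j y) ->
  (forall i (a : R) x, A i -> 0 <= a ->
    exists2 k, A k & F k (a *: x) <= a * F i x) ->
  let t x := inf [set F i x | i in A] in
  sublinear t /\ forall i x, A i -> t x <= F i x.
Proof.
move=> [i0 Ai0] Fb FD FZ t.
have tle i x : A i -> t x <= F i x.
  move=> Ai; apply: ge_inf; last by exists i.
  by exists (b x) => _ [j Aj <-]; exact: Fb.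
have le_t c x : (forall i, A i -> c <= F i x) -> c <= t x.
  move=> cF; apply: lb_le_inf; first by exists (F i0 x), i0.
  by move=> _ [i Ai <-]; exact: cF.
split => //; split=> [x y|a x].
- rewrite -lerBlDr; apply: (le_t) => i Ai; rewrite lerBlDr -lerBlDl.
  apply: (le_t) => j Aj; rewrite lerBlDl.
  by have [k Ak] := FD i j x y Ai Aj; apply: le_trans; exact: tle.
- rewrite le_eqVlt => /predU1P[<-|a0].
    have [k Ak] := FZ i0 0 x Ai0 (lexx _).
    by rewrite !mul0r; apply: le_trans; exact: tle.
  rewrite -ler_pdivrMl//; apply: (le_t) => i Ai; rewrite ler_pdivrMl//.
  by have [k Ak] := FZ i a x Ai (ltW a0); apply: le_trans; exact: tle.
Qed.

(** Take for [q' x] the infimum over [t >= 0] of [q (x + t *: v) - t * q v]: [t = 0] gives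
    [q' <= q], and [t = 1] at [- v] gives the last bound. *)
Lemma sublinear_shift q v : sublinear q ->
  exists q', [/\ sublinear q', forall x, q' x <= q x & q' (- v) <= - q v].
Proof.
move=> sq; pose F (t : R) x := q (x + t *: v) - t * q v.
have [] := @sublinear_inf R [set t | 0 <= t] F (fun x => - q (- x)).
- by exists 0 => /=.
- move=> t x /= t0; rewrite /F.
  have := sq.1 (x + t *: v) (- x); rewrite addrC addKr (sublinearZ _ sq t0).
  lra.
- move=> s t x y /= s0 t0; exists (s + t); first by rewrite addr_ge0.
  rewrite /F scalerDl addrACA mulrDl.
  have := sq.1 (x + s *: v) (y + t *: v); lra.
- move=> t a x /= t0 a0; exists (a * t); first by rewrite mulr_ge0.
  rewrite /F -scalerA -scalerDr; have := sq.2 a (x + t *: v) a0.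
  rewrite mulrBr mulrA; lra.
set q' := (fun x => _) => sq' q'le; exists q'; split => //.
  by move=> x; have := q'le 0 x (lexx _); rewrite /F scale0r addr0 mul0r subr0.
have := q'le 1 (- v) ler01.
by rewrite /F scale1r addNr (sublinear_at0 sq) mul1r sub0r.
Qed.

(** Zorn's lemma: a nonempty chain is bounded below by its pointwise infimum, finite because each
    member is at least [- p (- x)]. *)
Lemma sublinear_minimal p : sublinear p -> exists m,
  [/\ sublinear m, forall x, m x <= p x &
      forall q, sublinear q -> (forall x, q x <= m x) -> forall x, m x <= q x].
Proof.
move=> sp; pose T := {q : V -> R | sublinear q /\ forall x, q x <= p x}.
pose below (s t : T) := `[< forall x, sval t x <= sval s x >].
have sublinear_ge (t : T) x : - p (- x) <= sval t x.
  have [sq qp] := svalP t.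
  by apply: le_trans (sublinearN x sq); rewrite lerN2.
have [||A Atot|[m [sm mp]] mmin] :=
    @ZL_preorder T (exist _ p (conj sp (fun=> lexx _))) below.
- by move=> t; apply/asboolP.
- move=> r s t /asboolP rs /asboolP st; apply/asboolP => x.
  exact: le_trans (st x) (rs x).
- have [A0|/set0P/negP] := pselect (A !=set0); last first.
    rewrite negbK => /eqP ->.
    by exists (exist _ p (conj sp (fun=> lexx _))).
  have [|||st tle] := @sublinear_inf T A sval (fun x => - p (- x)) A0.
  + by move=> i x _; exact: sublinear_ge.
  + move=> i j x y Ai Aj; have [[sqi _] [sqj _]] := (svalP i, svalP j).
    have [/asboolP ij|/asboolP ji] := Atot i j Ai Aj.
      by exists j => //; have := sqj.1 x y; have := ij x; lra.
    by exists i => //; have := sqi.1 x y; have := ji y; lra.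
  + move=> i a x Ai a0; exists i => //.
    by have [[_ sqi] _] := svalP i; exact: sqi.
  have tp x : inf [set sval i x | i in A] <= p x.
    have [i Ai] := A0; have [_ ip] := svalP i.
    exact: le_trans (tle i x Ai) (ip x).
  pose t := fun x => inf [set sval i x | i in A].
  have tT : sublinear t /\ forall x, t x <= p x by [].
  by exists (exist _ t tT) => s As; apply/asboolP => x; exact: tle.
- exists m; split => // q sq qm x.
  have qp y : q y <= p y by exact: le_trans (qm y) (mp y).
  by have /(_ (asboolT qm))/asboolP/(_ x) := mmin (exist _ q (conj sq qp)).
Qed.

(* A minimal sublinear functional [m] is unchanged by the shift that makes it
   more additive along any [v]; hence it is odd, and so linear. *)
Lemma hahn_banach p v : sublinear p ->
  exists phi : V -> R^o,
    [/\ linear phi, forall x, phi x <= p x & phi v = p v].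
Proof.
(* Shifting along [v] before minimising gives [m (- v) <= - p v]; as [m] is odd, [m v = p v]
   follows. *)
move=> sp; have [p1 [sp1 p1p p1v]] := sublinear_shift v sp.
have [m [sm mp1 mmin]] := sublinear_minimal sp1.
have mN x : m (- x) = - m x.
  have [m' [sm' m'm m'x]] := sublinear_shift x sm.
  have := mmin m' sm' m'm (- x); have := sublinearN x sm; lra.
have mD x y : m (x + y) = m x + m y.
  apply/eqP; rewrite eq_le sm.1 /=.
  by have := sm.1 (- x) (- y); rewrite -opprD !mN; lra.
have mZ (a : R) x : m (a *: x) = a * m x.
  have [a0|a0] := leP 0 a; first exact: sublinearZ.
  rewrite -[a *: x]opprK -scaleNr mN sublinearZ//; last by rewrite oppr_ge0 ltW.
  by rewrite mulNr opprK.
exists m; split.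
- by move=> a x y; rewrite mD mZ.
- by move=> x; exact: le_trans (mp1 x) (p1p x).
- apply/eqP; rewrite eq_le (le_trans (mp1 v) (p1p v))/=.
  by have := mp1 (- v); rewrite mN; lra.
Qed.

End HahnBanach.

(** * Distance to a subspace and nets modulo a subspace *)

Section SubspaceDistance.
Context {R : realType} {V : normedModType R}.
Implicit Types (Z : set V) (x y z w : V).

Lemma subspace0 Z : linear_subspace Z -> Z 0.
Proof. by move=> [/set_mem]. Qed.

Lemma subspaceZD Z (a : R) x y : linear_subspace Z -> Z x -> Z y ->
  Z (a *: x + y).
Proof. by move=> [_ ZD] Zx Zy; apply/set_mem/ZD; exact/mem_set. Qed.

Lemma subspaceD Z x y : linear_subspace Z -> Z x -> Z y -> Z (x + y).
Proof.
by move=> sZ Zx Zy; rewrite -[x]scale1r; exact: subspaceZD.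
Qed.

Lemma subspaceZ Z (a : R) x : linear_subspace Z -> Z x -> Z (a *: x).
Proof.
by move=> sZ Zx; rewrite -[_ *: x]addr0; apply: subspaceZD => //; exact: subspace0.
Qed.

Lemma subspaceN Z x : linear_subspace Z -> Z x -> Z (- x).
Proof. by move=> sZ Zx; rewrite -scaleN1r; exact: subspaceZ. Qed.

Definition dist Z x : R := inf [set `|x - z| | z in Z].

Lemma dist_sublinear Z : linear_subspace Z ->
  sublinear (dist Z) /\ forall z x, Z z -> dist Z x <= `|x - z|.
Proof.
move=> sZ; apply: (@sublinear_inf R V V Z (fun z x => `|x - z|) (fun=> 0)).
- by exists 0; exact: subspace0.
- by [].
- move=> u v x y Zu Zv; exists (u + v); first exact: subspaceD.
  by rewrite opprD addrACA ler_normD.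
- move=> u a x Zu a0; exists (a *: u); first exact: subspaceZ.
  by rewrite -scalerBr normrZ ger0_norm.
Qed.

Lemma dist_le Z x z : linear_subspace Z -> Z z -> dist Z x <= `|x - z|.
Proof. by move=> /dist_sublinear[_]; exact. Qed.

Lemma dist_lt Z x (d : R) : linear_subspace Z -> dist Z x < d ->
  exists2 z, Z z & `|x - z| < d.
Proof.
move=> sZ /inf_lt[|_ [z Zz <-] zd]; last by exists z.
by exists `|x - 0|, 0 => //; exact: subspace0.
Qed.

Lemma bounded_linear_dual (phi : V -> R^o) (M : R) : linear phi ->
  (forall x, phi x <= M * `|x|) ->
  exists2 f : dual_space V, f =1 phi & forall x, `|f x| <= M * `|x|.
Proof.
move=> lphi phiM.
pose g : {linear V -> R^o} :=
  HB.pack phi (GRing.isLinear.Build _ _ _ _ _ lphi).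
have gM x : `|g x| <= M * `|x|.
  rewrite ler_norml phiM andbT lerNl -raddfN.
  by have := phiM (- x); rewrite normrN.
have gP : phi \in dual_pred.
  apply/asboolP; split => //.
  apply: (linear_bounded_continuous g).1; apply/bounded_funP => r.
  exists (`|M| * r) => x xr; apply: le_trans (gM x) _.
  apply: le_trans (ler_wpM2r (normr_ge0 x) (ler_norm M)) _.
  exact: ler_wpM2l.
by exists (DualSpace gP).
Qed.

(** Hahn-Banach dominated by the distance to [Z], which is at most the norm and vanishes on [Z]. *)
Lemma dist_dual Z w : linear_subspace Z -> exists f : dual_space V,
  [/\ forall x, `|f x| <= `|x|, forall z, Z z -> f z = 0 & f w = dist Z w].
Proof.
move=> sZ; have [sd dle] := dist_sublinear sZ.
have [phi [lphi phid phiw]] := hahn_banach w sd.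
have [x|f fphi fM] := @bounded_linear_dual phi 1 lphi.
  rewrite mul1r (le_trans (phid x))//.
  by have := dle 0 x (subspace0 sZ); rewrite subr0.
exists f; split; last by rewrite fphi.
- by move=> x; rewrite -[leRHS]mul1r.
- have f0 z : Z z -> f z <= 0.
    by move=> Zz; rewrite fphi (le_trans (phid z))// -(normr0 V) -(subrr z) dle.
  move=> z Zz; apply/eqP; rewrite eq_le f0//= -oppr_le0 -raddfN.
  by rewrite f0//; exact: subspaceN.
Qed.

Lemma norming_dual x : exists f : dual_space V,
  (forall y, `|f y| <= `|y|) /\ f x = `|x|.
Proof.
have sublinear_norm : sublinear (fun y : V => `|y|).
  split=> [u v|a u a0]; first exact: ler_normD.
  by rewrite normrZ ger0_norm.
have [phi [lphi phin phix]] := hahn_banach x sublinear_norm.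
have [y|f fphi fM] := @bounded_linear_dual phi 1 lphi; first by rewrite mul1r.
exists f; rewrite fphi; split => // y.
by have := fM y; rewrite mul1r.
Qed.

End SubspaceDistance.

(** * The canonical embedding into the bidual *)

Section Bidual.
Context {R : realType}.

Lemma dual_norm_leP {V : normedModType R} (f : dual_space V) (M : R) :
  0 <= M -> (forall x, `|f x| <= M * `|x|) -> `|f| <= M.
Proof.
move=> M0 fM; apply: dual_norm_le => x x1; apply: le_trans (fM x) _.
by rewrite -[leRHS]mulr1 ler_wpM2l.
Qed.

Lemma ler_dual_norm {V : normedModType R} (f : dual_space V) (x : V) :
  `|f x| <= `|f| * `|x|.
Proof. exact: dual_norm_ub. Qed.

Context {V : normedModType R}.

Lemma norm_bidual (x : V) : `|bidual_embedding x| = `|x|.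
Proof.
apply/eqP; rewrite eq_le; apply/andP; split.
  apply: dual_norm_leP => // f; rewrite mulrC.
  exact: (ler_dual_norm f x).
have [f [fle fx]] := norming_dual x.
have f1 : `|f| <= 1 by apply: dual_norm_leP => // y; rewrite mul1r.
have := ler_dual_norm (bidual_embedding x) f; rewrite [X in `|X|]fx normr_id.
move=> /le_trans; apply; by rewrite -[leRHS]mulr1 ler_wpM2l.
Qed.

Lemma bidual_linear : linear (@bidual_embedding R V).
Proof.
move=> a x y; apply/val_inj/funext => f /=.
by rewrite /evaluation linearP.
Qed.

HB.instance Definition _ := GRing.isLinear.Build R V _ _ _ bidual_linear.

Lemma bidual_subspace : linear_subspace (range (@bidual_embedding R V)).
Proof.
split; first by apply/mem_set; exists 0 => //; rewrite linear0.
move=> a _ _ /set_mem[x _ <-] /set_mem[y _ <-]; apply/mem_set.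
by exists (a *: x + y) => //; rewrite linearP.
Qed.

End Bidual.

Section Nets.
Context {R : realType}.

Lemma interval_net (A e : R) : 0 < e ->
  exists s : seq R, forall a, `|a| <= A -> exists2 g, g \in s & `|a - g| < e.
Proof.
move=> e0; pose N := Num.truncn (2 * A / e).
exists [seq i%:R * e - A | i <- iota 0 N.+1] => a.
rewrite ler_norml => /andP[Aa aA].
have aA0 : 0 <= (a + A) / e by apply: divr_ge0; [lra|exact: ltW].
pose i := Num.truncn ((a + A) / e).
have /andP[ile ilt] := truncn_itv aA0.
exists (i%:R * e - A).
  apply: (map_f (fun j : nat => j%:R * e - A)).
  rewrite mem_iota leq0n/= add0n ltnS.
  apply: le_truncn.
  by rewrite ler_pM2r ?invr_gt0//; lra.
rewrite ler_pdivlMr// in ile; rewrite ltr_pdivrMr// in ilt.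
rewrite -/i in ile ilt; rewrite -natr1 mulrDl mul1r in ilt.
by rewrite ltr_norml; apply/andP; split; lra.
Qed.

Context {V : normedModType R}.

Definition add_line (Z : set V) (c : V) : set V :=
  [set z + a *: c | z in Z & a in [set: R]].

Lemma add_line_subspace (Z : set V) c :
  linear_subspace Z -> linear_subspace (add_line Z c).
Proof.
move=> sZ; split.
  apply/mem_set; exists 0; first exact: subspace0.
  by exists 0 => //; rewrite scale0r addr0.
move=> k _ _ /set_mem[x Zx [l _ <-]] /set_mem[y Zy [m _ <-]]; apply/mem_set.
exists (k *: x + y); first exact: subspaceZD.
by exists (k * l + m) => //; rewrite scalerDr scalerDl scalerA addrACA.
Qed.

(** Moving a generator into the subspace drives the inductions on codimension. *)
Lemma add_line_codim (Z : set V) n (b : 'I_n.+1 -> V) :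
  (forall v, exists2 u, linear_span b u & Z (v - u)) ->
  forall v, exists2 u, linear_span (b \o lift ord0) u &
    add_line Z (b ord0) (v - u).
Proof.
move=> bZ v; have [_ [a _ <-] Zv] := bZ v.
exists (\sum_(i < n) a (lift ord0 i) *: b (lift ord0 i)).
  by exists (a \o lift ord0).
exists (v - \sum_(i < n.+1) a i *: b i) => //.
exists (a ord0) => //; rewrite big_ord_recl opprD.
by rewrite addrA addrAC subrK.
Qed.

Lemma ball_net (Z : set V) (r e : R) : linear_subspace Z -> finite_codim Z ->
  0 < e -> exists s : seq V, forall v, `|v| <= r ->
    exists w z, [/\ w \in s, Z z & `|v - w - z| < e].
Proof.
move=> sZ [n [b bZ]]; elim: n b => [|n IH] b in Z sZ bZ r e *.
  move=> e0; exists [:: 0] => v _; exists 0, v.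
  rewrite mem_seq1 eqxx subr0 subrr normr0; split => //.
  have [_ [a _ <-]] := bZ v.
  by rewrite big_ord0 subr0.
move=> e0; pose c := b ord0.
have sZ' := add_line_subspace c sZ; have bZ' := add_line_codim bZ.
have e20 : 0 < e / 2 by rewrite divr_gt0.
have [s sP] := IH _ _ sZ' bZ' r (e / 2) e20.
(* At distance [0], possible for [c] outside a non-closed [Z], multiples of [c] are absorbed by [Z]
   up to [e / 2] and the net is kept. *)
have [d0|d0] := leP (dist Z c) 0.
  exists s => v vr; have [w [_ [ws [z Zz [a _ <-]]] vw]] := sP v vr.
  have a10 : 0 < `|a| + 1 by rewrite ltr_pwDr.
  have [|z' Zz' cz'] := @dist_lt _ _ Z c (e / 2 / (`|a| + 1)) sZ.
    by apply: le_lt_trans d0 _; rewrite divr_gt0.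
  exists w, (z + a *: z'); split => //.
    by apply: subspaceD => //; exact: subspaceZ.
  have -> : v - w - (z + a *: z') = (v - w - (z + a *: c)) + a *: (c - z').
    by rewrite scalerBr !opprD !addrA subrK.
  apply: le_lt_trans (ler_normD _ _) _; rewrite normrZ.
  have : `|a| * `|c - z'| < e / 2.
    move: cz'; rewrite ltr_pdivlMr// mulrC; apply: le_lt_trans.
    by rewrite ler_wpM2r// lerDl.
  lra.
pose S := \big[Order.max/0]_(w <- s) `|w|.
have Sle w : w \in s -> `|w| <= S.
  by move=> ws; rewrite /S; apply: le_bigmax_seq.
(* Otherwise the coefficients of [c] are bounded, by [|a| * dist Z c <= |z + a *: c| <= r + S + e],
   and a net of them refines [s]. *)
have [|G GP] := @interval_net ((r + S + e) / dist Z c) (e / 2 / (`|c| + 1)).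
  by rewrite divr_gt0// ltr_pwDr.
exists [seq w + g *: c | w <- s, g <- G] => v vr.
have [w [_ [ws [z Zz [a _ <-]]] vw]] := sP v vr.
have [|g gG ag] := GP a.
  rewrite ler_pdivlMr//.
  have -> : `|a| * dist Z c = dist Z (`|a| *: c).
    by rewrite (sublinearZ _ (dist_sublinear sZ).1).
  have dza : dist Z (`|a| *: c) <= `|z + a *: c|.
    have [a0|a0] := leP 0 a.
      rewrite ger0_norm// addrC -[z in leRHS]opprK.
      by apply: dist_le => //; exact: subspaceN.
    by rewrite ltr0_norm// -normrN opprD addrC -scaleNr; exact: dist_le.
  apply: le_trans dza _.
  have -> : z + a *: c = v - w - (v - w - (z + a *: c)) by rewrite subKr.
  have := ler_normB (v - w) (v - w - (z + a *: c)).
  have := ler_normB v w; have := Sle w ws; lra.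
exists (w + g *: c), z; split => //.
  by apply/allpairsP; exists (w, g).
have -> : v - (w + g *: c) - z = (v - w - (z + a *: c)) + (a - g) *: c.
  by rewrite scalerBl !opprD !addrA subrK [LHS]addrAC.
apply: le_lt_trans (ler_normD _ _) _; rewrite normrZ.
have : `|a - g| * `|c| < e / 2.
  move: ag; rewrite ltr_pdivlMr ?ltr_pwDr//; apply: le_lt_trans.
  by rewrite ler_wpM2l// lerDl.
lra.
Qed.

End Nets.

(** * Ultrafilters and iterated weak-star limits *)

Section Ultrafilters.

Lemma free_ultrafilter : exists U : set_system nat,
  UltraFilter U /\ forall N, U [set n | (N < n)%N].
Proof.
have [U [ultraU sU]] := ultraFilterLemma eventually_filter.
by exists U; split => // N; apply: sU; exists N.+1.
Qed.

Lemma ultra_dichotomy (T : Type) (F : set_system T) :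
  ProperFilter F -> (forall A, F A \/ F (~` A)) -> UltraFilter F.
Proof.
move=> PF FC; split => // G PG FG; apply/seteqP; split => // A GA.
have [//|/FG GnA] := FC A.
have GA0 : G (A `&` ~` A) by exact: filterI.
by have /filter_ex[x []] := GA0.
Qed.

(** The Fubini product of [F] with itself: the second coordinate is chosen after the first. For free
    [F] on the integers it contains the set of increasing pairs. *)
Definition iterated_filter (T : Type) (F : set_system T) : set_system (T * T) :=
  [set A | \forall x \near F, \forall y \near F, A (x, y)].

Lemma iterated_filter_ultra (T : Type) (F : set_system T) :
  UltraFilter F -> UltraFilter (iterated_filter F).
Proof.
move=> UF; apply: ultra_dichotomy.
  apply: Build_ProperFilter_ex.
    by move=> A /(@filter_ex _ F)[x] /(@filter_ex _ F)[y] Axy; exists (x, y).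
  split.
  - by apply: (@filterE _ F) => x; exact: (@filterE _ F).
  - move=> A B FA FB; apply: (@filterS2 _ F) FA FB => x.
    exact: (@filterS2 _ F).
  - move=> A B AB; apply: (@filterS _ F) => x; apply: (@filterS _ F) => y.
    exact: AB.
move=> A.
have [|FnA] := in_ultra_setVsetC [set x | \forall y \near F, A (x, y)] UF.
  by left.
right; apply: (@filterS _ F) FnA => x.
by have [|] := in_ultra_setVsetC [set y | A (x, y)] UF.
Qed.

(** Otherwise every [~ P t i] holds along the ultrafilter, hence all at once by finiteness. *)
Lemma ultra_pigeonhole (T : Type) (F : set_system T) (I : finType)
    (P : T -> I -> Prop) : UltraFilter F ->
  (\forall t \near F, exists i, P t i) -> exists i, \forall t \near F, P t i.
Proof.
move=> UF FP; apply: contrapT => noi.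
have FnP i : \forall t \near F, ~ P t i.
  have [Fi|//] := in_ultra_setVsetC [set t | P t i] UF.
  by exfalso; apply: noi; exists i.
have : \forall t \near F, forall i, i \in enum I -> ~ P t i.
  elim: (enum I) => [|i s IH]; first by apply: filterE.
  apply: filterS2 (FnP i) IH => t nPi ns j.
  by rewrite inE => /predU1P[->//|]; exact: ns.
move=> FnPe; have /filter_ex[t [[i Pi] nP]] : \forall t \near F,
    (exists i, P t i) /\ forall i, i \in enum I -> ~ P t i by exact: filterI.
by apply: nP Pi; rewrite mem_enum.
Qed.

Context {R : realType}.

Lemma ultra_bounded_cvg (T : Type) (F : set_system T) (x : T -> R) (M : R) :
  UltraFilter F -> (forall t, `|x t| <= M) ->
  exists l : R, x t @[t --> F] --> l.
Proof.
move=> UF xM; pose S := [set a | \forall t \near F, a <= x t].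
have xMM t : - M <= x t <= M by rewrite -ler_norml.
have supS : has_sup S.
  split; first by exists (- M); near=> t; have /andP[] := xMM t.
  exists M => a /filter_ex[t at_]; apply: le_trans at_ _.
  by have /andP[] := xMM t.
exists (sup S); apply/cvgrPdist_lt => e e0.
have [a Sa ale] := sup_adherent e0 supS.
have [Fle|Fgt] := in_ultra_setVsetC [set t | sup S + e / 2 <= x t] UF.
  have : sup S + e / 2 <= sup S by apply: ub_le_sup => //; exact: supS.2.
  by lra.
apply: filterS2 Sa Fgt => t axt /= /negP; rewrite -ltNge => xt.
by rewrite ltr_norml; apply/andP; split; lra.
Unshelve. all: by end_near. Qed.

Lemma cvg_norm_le (T : Type) (F : set_system T) (x : T -> R) (l M : R) :
  ProperFilter F -> x t @[t --> F] --> l ->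
  (\forall t \near F, `|x t| <= M) -> `|l| <= M.
Proof.
move=> PF /cvgrPdist_lt xl xM; rewrite leNgt; apply/negP => Ml.
have : 0 < `|l| - M by rewrite subr_gt0.
move=> /xl xl'; have /filter_ex[t [/= lx xtM]] : \forall t \near F,
    `|l - x t| < `|l| - M /\ `|x t| <= M by exact: filterI.
have := ler_distD 0 l (x t); rewrite subr0 sub0r normrN.
have := ler_normD (l - x t) (x t); rewrite subrK; lra.
Qed.

End Ultrafilters.

Section WeakStarLimits.
Context {R : realType} {V : normedModType R}.
Notation W := (dual_space V).

(* The weak-star limit along [F]; it is [0] if there is none. *)
Definition wlim (T : Type) (F : set_system T) (h : T -> W) : W :=
  xget (0 : W) [set g : W | forall v, (h t v : R) @[t --> F] --> (g v : R)].

(** Banach-Alaoglu along an ultrafilter: pointwise limits exist by boundedness and form a functional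
    bounded by [M], so the default in [wlim] is not taken. *)
Lemma wlimP (T : Type) (F : set_system T) (h : T -> W) (M : R) :
  UltraFilter F -> (forall t, `|h t| <= M) ->
  forall v, (h t v : R) @[t --> F] --> (wlim F h v : R).
Proof.
move=> UF hM; rewrite /wlim; case: xgetP => [g _ //|noG]; exfalso.
have lim v : exists l : R, (h t v : R) @[t --> F] --> l.
  apply: (@ultra_bounded_cvg _ _ F _ (M * `|v|)) => t.
  by apply: le_trans (ler_dual_norm _ _) _; exact: ler_wpM2r.
have [g gP] := choice lim.
have [||f fg _] := @bounded_linear_dual R V g M.
- move=> a x y; apply: (cvg_unique _ (gP _)) => //.
  have -> : (fun t => h t (a *: x + y) : R) = (fun t => a * h t x + h t y).
    by apply/funext => t; rewrite linearP.
  by apply: cvgD => //; apply: cvgMr; exact: gP.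
- move=> x; apply: le_trans (ler_norm _) _; apply: (cvg_norm_le _ (gP x)).
  apply: filterE => t.
  by apply: le_trans (ler_dual_norm _ _) _; exact: ler_wpM2r.
by apply: (noG f) => v; rewrite fg; exact: gP.
Qed.

Lemma wlim_norm_le (T : Type) (F : set_system T) (h : T -> W) (M : R) :
  UltraFilter F -> (forall t, `|h t| <= M) -> `|wlim F h| <= M.
Proof.
move=> UF hM; have hl := wlimP UF hM.
have [t _] := @filter_ex _ F _ _ filterT.
apply: dual_norm_leP => [|v]; first exact: le_trans (normr_ge0 _) (hM t).
apply: (cvg_norm_le _ (hl v)); apply: filterE => s.
by apply: le_trans (ler_dual_norm _ _) _; exact: ler_wpM2r.
Qed.

Lemma wlim_dist_le (T : Type) (F : set_system T) (h h' : T -> W) (M L : R) :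
  UltraFilter F -> (forall t, `|h t| <= M) -> (forall t, `|h' t| <= M) ->
  (forall t, `|h t - h' t| <= L) -> `|wlim F h - wlim F h'| <= L.
Proof.
move=> UF hM hM' hL; have [hl hl'] := (wlimP UF hM, wlimP UF hM').
have [t _] := @filter_ex _ F _ _ filterT.
apply: dual_norm_leP => [|v]; first exact: le_trans (normr_ge0 _) (hL t).
apply: (cvg_norm_le _ (cvgB (hl v) (hl' v))); apply: filterE => s.
apply: (le_trans (ler_dual_norm (h s - h' s) v)); exact: ler_wpM2r.
Qed.

Lemma wlim_dist_cst (T : Type) (F : set_system T) (h : T -> W) (g : W)
    (M L : R) :
  UltraFilter F -> (forall t, `|h t| <= M) ->
  (forall t, `|g - h t| <= L) -> `|g - wlim F h| <= L.
Proof.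
move=> UF hM hL; have hl := wlimP UF hM.
have [t _] := @filter_ex _ F _ _ filterT.
apply: dual_norm_leP => [|v]; first exact: le_trans (normr_ge0 _) (hL t).
apply: (cvg_norm_le _ (cvgB (cvg_cst (g v : R)) (hl v))).
apply: filterE => s.
apply: (le_trans (ler_dual_norm (g - h s) v)); exact: ler_wpM2r.
Qed.

Variable U : set_system nat.
Hypothesis ultraU : UltraFilter U.

Fixpoint iterlim (k : nat) (f : seq nat -> W) : W :=
  if k is k'.+1 then wlim U (fun n => iterlim k' (f \o cons n)) else f [::].

Lemma iterlim_norm_le (M : R) k (f : seq nat -> W) :
  (forall s, size s = k -> `|f s| <= M) -> `|iterlim k f| <= M.
Proof.
elim: k f => [|k IH] f fM /=; first exact: fM.
by apply: wlim_norm_le => n; apply: IH => s sk; apply: fM; rewrite /= sk.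
Qed.

Lemma iterlim_dist_le (M M' L : R) k (f f' : seq nat -> W) :
  (forall s, size s = k -> `|f s| <= M) ->
  (forall s, size s = k -> `|f' s| <= M') ->
  (forall s, size s = k -> `|f s - f' s| <= L) ->
  `|iterlim k f - iterlim k f'| <= L.
Proof.
elim: k f f' => [|k IH] f f' fM fM' fL /=; first exact: fL.
apply: (@wlim_dist_le _ _ _ _ (Order.max M M')) => n.
- apply: iterlim_norm_le => s sk.
  by rewrite le_max fM//= sk.
- apply: iterlim_norm_le => s sk.
  by rewrite le_max fM' ?orbT//= sk.
- by apply: IH => s sk; [apply: fM|apply: fM'|apply: fL]; rewrite /= sk.
Qed.

(** Lipschitz for the Hamming distance; boundedness is there for the weak-star limits to exist. *)
Definition hamming_lipschitz (k : nat) (L : R) (f : seq nat -> W) : Prop :=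
  (exists M, forall s, size s = k -> `|f s| <= M) /\
  forall s1 a b s2, size (s1 ++ a :: s2) = k ->
    `|f (s1 ++ a :: s2) - f (s1 ++ b :: s2)| <= L.

Lemma hamming_lipschitz_cons k L f n : hamming_lipschitz k.+1 L f ->
  hamming_lipschitz k L (f \o cons n).
Proof.
move=> [[M fM] fL]; split.
  by exists M => s sk; apply: fM; rewrite /= sk.
by move=> s1 a b s2 sk; apply: (fL (n :: s1)); rewrite /= sk.
Qed.

(** A martingale-type difference: the effect on the iterated limit of fixing the first entry. Along
    a branch the increments telescope to [f] minus its iterated limit. *)
Definition increment k f n : W := iterlim k (f \o cons n) - iterlim k.+1 f.

Lemma increment_cvg0 k L f v : hamming_lipschitz k.+1 L f ->
  (increment k f n v : R) @[n --> U] --> (0 : R).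
Proof.
move=> [[M fM] _].
have -> : (fun n => increment k f n v : R) =
    (fun n => iterlim k (f \o cons n) v - iterlim k.+1 f v) by [].
rewrite -(subrr (iterlim k.+1 f v : R)); apply: cvgB; last exact: cvg_cst.
apply: (@wlimP _ _ _ M) => n.
by apply: iterlim_norm_le => s sk; apply: fM; rewrite /= sk.
Qed.

Lemma increment_norm_le k L f n : hamming_lipschitz k.+1 L f ->
  `|increment k f n| <= L.
Proof.
move=> [[M fM] fL]; rewrite /increment.
have boundJ m s : size s = k -> `|(f \o cons m) s| <= M.
  by move=> sk; apply: fM; rewrite /= sk.
apply: (@wlim_dist_cst _ _ _ _ M) => m.
  by apply: iterlim_norm_le => s; exact: boundJ.
apply: (@iterlim_dist_le M M) => s sk; [exact: boundJ|exact: boundJ|].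
by apply: (fL [::]); rewrite /= sk.
Qed.

End WeakStarLimits.

(** * Asymptotic uniform smoothness *)

Section OneStep.
Context {R : realType}.

Lemma powR_chord (p a s : R) : 1 <= p -> 0 <= a -> 0 <= s -> s <= 1 ->
  (1 + a * s) `^ p <= 1 + s * (1 + a) `^ p.
Proof.
move=> p1 a0 s0 s1.
have : (s * (1 + a) + (1 - s) * 1) `^ p <=
    s * (1 + a) `^ p + (1 - s) * 1 `^ p.
  have := @convex_powR R p p1 (Itv01 s0 s1) (1 + a) 1.
  rewrite !inE /= !in_itv /= !andbT => /(_ (addr_ge0 ler01 a0) ler01).
  by rewrite !convRE.
rewrite powR1.
have -> : s * (1 + a) + (1 - s) * 1 = 1 + a * s by ring.
move=> /le_trans; apply; have := powR_ge0 (1 + a) p; lra.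
Qed.

Lemma powR_growth (p a : R) : 1 <= p -> 0 <= a -> exists2 K : R, 0 < K &
  forall D b b' : R, 0 < D -> 0 <= b -> 0 <= b' ->
    (b < D -> b' <= 2 * D) -> (D <= b -> b' <= b * (1 + a * (D / b) `^ p)) ->
    b' `^ p <= b `^ p + K * D `^ p.
Proof.
move=> p1 a0; have p0 : 0 <= p by lra.
exists (2 `^ p + (1 + a) `^ p).
  by apply: addr_gt0; apply: powR_gt0; lra.
move=> D b b' D0 b0 b'0 small large; have [bD|Db] := ltP b D.
  apply: (@le_trans _ _ ((2 * D) `^ p)).
    by apply: ge0_ler_powR; rewrite ?nnegrE//; [lra|exact: small].
  rewrite powRM ?(ltW D0)// mulrDl.
  have := powR_ge0 b p; have := mulr_ge0 (powR_ge0 (1 + a) p) (powR_ge0 D p).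
  lra.
have b_gt0 : 0 < b by exact: lt_le_trans Db.
have Db0 : 0 <= D / b by rewrite divr_ge0// ltW.
have s1 : (D / b) `^ p <= 1.
  have <- : 1 `^ p = 1 :> R by rewrite powR1.
  by apply: ge0_ler_powR; rewrite ?nnegrE// ler_pdivrMr// mul1r.
apply: (@le_trans _ _ ((b * (1 + a * (D / b) `^ p)) `^ p)).
  apply: ge0_ler_powR; rewrite ?nnegrE ?large//.
  by rewrite mulr_ge0// addr_ge0// mulr_ge0// powR_ge0.
rewrite powRM//; last by rewrite addr_ge0// mulr_ge0// powR_ge0.
have := powR_chord p1 a0 (powR_ge0 (D / b) p) s1.
move=> /(ler_wpM2l (powR_ge0 b p)); move=> /le_trans; apply.
rewrite mulrDr mulr1 mulrA -powRM//.
have -> : b * (D / b) = D by rewrite mulrC divfK// gt_eqF.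
rewrite lerD2l mulrC ler_wpM2r ?powR_ge0// lerDr powR_ge0//.
Qed.

Context {Y : normedModType R}.

Lemma AUS_step (p : R) : AUS p Y -> exists2 c : R, 0 < c &
  forall (u : Y) (T : R), u != 0 -> 0 < T ->
    exists2 Z, cofinite_subspace Z & forall z, Z z -> `|z| <= T ->
      `|u + z| <= `|u| * (1 + c * (T / `|u|) `^ p).
Proof.
(* Doubling [c] makes the bound on the modulus strict, so that a single subspace realises it. *)
move=> [c c0 cP]; exists (2 * c); first by rewrite mulr_gt0.
move=> u T u0 T0; have nu : 0 < `|u| by rewrite normr_gt0.
have nu0 : `|u| != 0 by rewrite gt_eqF.
pose x := `|u|^-1 *: u; pose t := T / `|u|.
have t0 : 0 < t by rewrite divr_gt0.
have x1 : `|x| = 1 by rewrite normrZ normfV normr_id mulVf.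
have tp0 : 0 < t `^ p by exact: powR_gt0.
have : (aus_modulus_at t x < (2 * c * t `^ p)%:E)%E.
  apply: (@le_lt_trans _ _ (aus_modulus (X := Y) t)).
    by apply: ereal_sup_ubound; exists x.
  apply: le_lt_trans (cP t (ltW t0)) _.
  by rewrite lte_fin; have := mulr_gt0 c0 tp0; lra.
move=> /ereal_inf_lt[_ [Z cZ <-] Zlt]; exists Z => // z Zz zT.
have ct0 : 0 <= 2 * c * t `^ p by rewrite !mulr_ge0// ?ltW.
have [->|z0] := eqVneq z 0.
  by rewrite addr0 ler_peMr// lerDl.
have nz : 0 < `|z| by rewrite normr_gt0.
have nz0 : `|z| != 0 by rewrite gt_eqF.
move: Zlt; rewrite /aus_modulus_at_in; case: ifPn => [/eqP Z0|_ Zlt].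
  by move: Zz; rewrite Z0 => /= zz; rewrite zz eqxx in z0.
pose z1 := `|z|^-1 *: z.
have z1P : sphere Z z1.
  split; first by case: cZ => sZ _ _; exact: subspaceZ.
  by rewrite normrZ normfV normr_id mulVf.
have : `|x + t *: z1| - 1 < 2 * c * t `^ p.
  by rewrite -lte_fin; apply: le_lt_trans Zlt; apply: ereal_sup_ubound; exists z1.
move=> xz; pose s := `|z| / T.
have s0 : 0 <= s by rewrite divr_ge0// ltW.
have s1 : s <= 1 by rewrite ler_pdivrMr// mul1r.
(* Convexity reduces norm at most [T] to norm [T]: up to the factor [|u|], this is a point of the
   segment from [x] to [x + t *: z1]. *)
have -> : u + z = `|u| *: ((1 - s) *: x + s *: (x + t *: z1)).
  rewrite [s *: (_ + _)]scalerDr addrA -scalerDl subrK scale1r scalerDr !scalerA.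
  have -> : `|u| / `|u| = 1 by rewrite divff.
  rewrite scale1r; congr (_ + _).
  have -> : `|u| * s * t / `|z| = 1; last by rewrite scale1r.
  by rewrite /s /t; field; rewrite nz0 nu0 (gt_eqF T0).
rewrite normrZ normr_id ler_wpM2l//.
apply: le_trans (ler_normD _ _) _.
rewrite [`|(1 - s) *: x|]normrZ [`|s *: (_ + _)|]normrZ x1 mulr1.
rewrite ger0_norm ?subr_ge0// (ger0_norm s0).
have : s * `|x + t *: z1| <= s * (1 + 2 * c * t `^ p) by rewrite ler_wpM2l//; lra.
have := ler_wpM2r ct0 s1; rewrite -/t; lra.
Qed.

(** Modulo [Z], the [y t] cluster at one net point [w]. A functional vanishing on [Z] and attaining
    [dist Z w] at [w] is tested on [v t], which tends to [0]; hence [w] is almost within [d] of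
    [Z]. *)
Lemma wnull_near_subspace (T : Type) (F : set_system T) (y : T -> Y)
    (v : T -> dual_space (dual_space Y)) (Z : set Y) (r d d' : R) :
  UltraFilter F -> (\forall t \near F, `|y t| <= r) ->
  (\forall t \near F, `|v t - bidual_embedding (y t)| <= d) ->
  (forall phi, (v t phi : R) @[t --> F] --> (0 : R)) ->
  linear_subspace Z -> finite_codim Z -> d < d' ->
  \forall t \near F, exists2 z, Z z & `|y t - z| < d'.
Proof.
(* With [d' = d + 5 * e]: [w] will be within [d + 3 * e] of [Z], and [y t - w] within [e]. *)
move=> UF yr yd v0 sZ fZ dd'; pose e := (d' - d) / 5.
have e0 : 0 < e by rewrite divr_gt0// subr_gt0.
have [s sP] := ball_net r sZ fZ e0.
have [|i iP] := @ultra_pigeonhole _ _ 'I_(size s)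
    (fun t i => exists2 z, Z z & `|y t - s`_i - z| < e) UF.
  apply: filterS yr => t /sP[w [z [ws Zz yz]]].
  have si : (index w s < size s)%N by rewrite index_mem.
  by exists (Ordinal si); exists z => //=; rewrite nth_index.
pose w := s`_i; have [phi [phi1 phi0 phiw]] := dist_dual w sZ.
have nphi : `|phi| <= 1 by apply: dual_norm_leP => // x; rewrite mul1r.
have : \forall t \near F, `|v t phi| < e.
  have := v0 phi => /cvgrPdist_lt/(_ e e0).
  by apply: filterS => t /=; rewrite sub0r normrN.
move=> ve; have /filter_ex[t [[[z Zz ywz] ydt] vet]] : \forall t \near F,
    ((exists2 z, Z z & `|y t - w - z| < e) /\
     `|v t - bidual_embedding (y t)| <= d) /\ `|v t phi| < e.
  by apply: filterI => //; exact: filterI.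
have : dist Z w < d + 3 * e.
  have h1 : `|phi (y t - w - z)| < e by exact: le_lt_trans (phi1 _) ywz.
  have h2 : `|v t phi - phi (y t)| <= d.
    apply: le_trans (ler_dual_norm (v t - bidual_embedding (y t)) phi) _.
    by rewrite -[leRHS]mulr1; apply: ler_pM.
  move: h1; rewrite !linearB /= (phi0 _ Zz) subr0 phiw.
  move: h2 vet; rewrite ler_norml !ltr_norml.
  by move=> /andP[? ?] /andP[? ?] /andP[? ?]; lra.
move=> /(dist_lt sZ)[z0 Zz0 wz0]; apply: filterS iP => t' [z' Zz' yz'].
exists (z' + z0); first exact: subspaceD.
have -> : y t' - (z' + z0) = (y t' - w - z') + (w - z0).
  by rewrite opprD !addrA [X in _ = X - _]addrAC subrK.
apply: le_lt_trans (ler_normD _ _) _.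
have : d' = d + 5 * e by rewrite /e; lra.
by move: yz'; rewrite -/w; lra.
Qed.

End OneStep.

(** * Interlaced tuples *)

Section Game.
Context {R : realType} {Y : normedModType R}.
Notation W := (dual_space (dual_space Y)).
Notation kappa := (@bidual_embedding R Y).

(* [N] bounds the number of steps to be played: as [|u| <= D * N], the error
   [3 * eta] is absorbed by the smoothness term [|u| * (D / |u|) `^ p]. *)
Lemma AUS_wnull_step (p : R) : 1 < p -> AUS p Y -> exists2 K : R, 0 < K &
  forall (T : Type) (F : set_system T) (v : T -> W) (u : Y) (L N eta : R),
    let D := 3 * L in
    UltraFilter F -> 0 < L -> 0 < N -> 0 < eta -> 5 * eta <= L ->
    3 * eta <= D * N^-1 `^ p -> `|u| <= D * N ->
    (forall t, `|v t| <= 2 * L) ->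
    (forall phi, (v t phi : R) @[t --> F] --> (0 : R)) ->
    (\forall t \near F, exists y, `|v t - kappa y| <= 2 * eta) ->
    \forall t \near F, exists y, [/\ `|v t - kappa y| <= 2 * eta, `|y| <= D &
      `|u + y| `^ p <= `|u| `^ p + K * D `^ p].
Proof.
(* Passing from [c] to [c + 1] pays for the error [3 * eta]. *)
move=> p1 /AUS_step[c c0 cP]; have c1 : 0 <= c + 1 by lra.
have [K K0 KP] := powR_growth (ltW p1) c1; exists K => //.
move=> T F v u L N eta D UF L0 N0 eta0 etaL etaN uN vL v0 vy.
have D0 : 0 < D by rewrite mulr_gt0.
pose y t := xget 0 [set y | `|v t - kappa y| <= 2 * eta].
have yP : \forall t \near F, `|v t - kappa (y t)| <= 2 * eta.
  by apply: filterS vy => t; exact: xgetPex.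
have yn : \forall t \near F, `|y t| <= 2 * L + 2 * eta.
  apply: filterS yP => t yt; rewrite -norm_bidual.
  have := ler_normB (v t) (v t - kappa (y t)); rewrite subKr.
  by have := vL t; lra.
(* If [|u| < D], the trivial bound [|u + y| <= 2 * D] suffices. *)
have [uD|Du] := ltP `|u| D.
  apply: filterS2 yP yn => t yt ynt; exists (y t); split => //.
    by rewrite /D; lra.
  apply: (KP _ `|u|) => // [_|]; last by rewrite leNgt uD.
  by have := ler_normD u (y t); rewrite /D in uD *; lra.
have nu : 0 < `|u| by exact: lt_le_trans Du.
have u0 : u != 0 by rewrite -normr_gt0.
have [Z [sZ _ fZ] ZP] := cP u D u0 D0.
have eta23 : 2 * eta < 3 * eta by lra.
have yZ := wnull_near_subspace UF yn yP v0 sZ fZ eta23.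
have etau : 3 * eta <= `|u| * (D / `|u|) `^ p.
  apply: le_trans etaN _; apply: ler_pM => //; first exact: ltW.
    exact: powR_ge0.
  apply: ge0_ler_powR; rewrite ?nnegrE ?invr_ge0 ?divr_ge0 ?(ltW D0) ?(ltW N0)//.
    by lra.
  by rewrite ler_pdivlMr// mulrC ler_pdivrMr.
apply: filterS3 yP yn yZ => t yt ynt [z Zz yz].
exists (y t); split => //; first by rewrite /D; lra.
apply: (KP _ `|u|) => // [|_]; first by rewrite ltNge Du.
(* [|z| <= 2 * L + 5 * eta <= 3 * L] explains the factor [3] in [D] and the condition
   [5 * eta <= L]. *)
have zD : `|z| <= D.
  have := ler_normB (y t) (y t - z); rewrite subKr /D; lra.
have := ZP z Zz zD; have := ler_normD (u + z) (y t - z).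
have -> : u + z + (y t - z) = u + y t by rewrite addrACA subrr addr0.
by rewrite mulrDl mul1r; lra.
Qed.

Variable U : set_system nat.
Hypothesis ultraU : UltraFilter U.
Hypothesis freeU : forall N, U [set n | (N < n)%N].

Variables (N : nat) (w : 'I_N -> W) (L eta : R).

(** Colours are classes modulo [Y]: two elements of one colour differ by a vector of [Y] up to
    [2 * eta]. *)
Definition coloured (i : 'I_N) (z : W) : Prop :=
  exists y : Y, `|z - w i - kappa y| <= eta.

(* [t] lists the iterated [U]-limits of the colours of the successive increments
   of [f]; functions of the same type have increments that agree modulo [Y]. *)
Fixpoint has_type (t : seq 'I_N) (f : seq nat -> W) : Prop :=
  if t is i :: t' then
    (\forall n \near U, coloured i (increment U (size t') f n)) /\
    \forall n \near U, has_type t' (f \o cons n)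
  else True.

(** Colours and types of a given length are finite in number, so the pigeonhole principle along [U]
    fixes the first colour and the type of the remaining function. *)
Lemma exists_type k (f : seq nat -> W) : hamming_lipschitz k L f ->
  (forall z, `|z| <= L -> exists i, coloured i z) ->
  exists t : k.-tuple 'I_N, has_type t f.
Proof.
move=> fL wL; elim: k f fL => [|k IH] f fL; first by exists [tuple].
have [|i iP] := @ultra_pigeonhole _ U _
    (fun n i => coloured i (increment U k f n)) ultraU.
  by apply: filterE => n; apply: wL; exact: (increment_norm_le ultraU).
have [|t tP] := @ultra_pigeonhole _ U (k.-tuple 'I_N)
    (fun n t => has_type t (f \o cons n)) ultraU.
  by apply: filterE => n; apply: IH; exact: hamming_lipschitz_cons.
exists (cons_tuple i t); split; last exact: tP.
by rewrite size_tuple; exact: iP.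
Qed.

Fixpoint interlaced (m : nat) (s : seq (nat * nat)) : Prop :=
  if s is ab :: s' then [/\ (m < ab.1)%N, (ab.1 < ab.2)%N & interlaced ab.2 s']
  else True.

Let color_sub (z z' c y y' : W) :
  z - z' - (y - y') = (z - c - y) - (z' - c - y').
Proof.
rewrite [z - c - y]addrAC [z' - c - y']addrAC [z' - y' - c]addrC addrKA !opprB.
by rewrite addrACA [RHS]addrACA [- z' - y]addrC.
Qed.

Let step_sub (x y a b a' b' : W) :
  x + y - (a - b) = x - (a' - b') - (a - a' - (b - b') - y).
Proof.
have -> : a - a' - (b - b') = a - b - (a' - b').
  by rewrite !opprB addrACA [RHS]addrACA [- a' - b]addrC.
move: (a - b) (a' - b') => p q.
by rewrite !opprB [y + _]addrC addrA subrKA addrAC.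
Qed.

(** The vector [u] of [Y] approximates the difference of the iterated limits within [d]. Each round
    fixes one pair of entries and corrects [u] by some [y]; it costs [2 * eta] in the approximation
    and [K * D ^ p] in the [p]-th power of the norm. The budget [D * N0] keeps [u] in the range of
    the one-round estimate. *)
Lemma interlaced_play (p K N0 : R) :
  let D := 3 * L in
  (forall (T : Type) (F : set_system T) (v : T -> W) (u : Y),
    UltraFilter F -> `|u| <= D * N0 -> (forall t, `|v t| <= 2 * L) ->
    (forall phi, (v t phi : R) @[t --> F] --> (0 : R)) ->
    (\forall t \near F, exists y, `|v t - kappa y| <= 2 * eta) ->
    \forall t \near F, exists y, [/\ `|v t - kappa y| <= 2 * eta, `|y| <= D &
      `|u + y| `^ p <= `|u| `^ p + K * D `^ p]) ->
  0 < D ->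
  forall (t : seq 'I_N) (f f' : seq nat -> W) (u : Y) (m : nat) (d : R),
    hamming_lipschitz (size t) L f -> hamming_lipschitz (size t) L f' ->
    has_type t f -> has_type t f' ->
    `|kappa u - (iterlim U (size t) f - iterlim U (size t) f')| <= d ->
    `|u| + D * (size t)%:R <= D * N0 ->
    exists s v, [/\ size s = size t, interlaced m s,
      `|kappa v - (f (unzip1 s) - f' (unzip2 s))| <= d + 2 * eta * (size t)%:R &
      `|v| `^ p <= `|u| `^ p + K * D `^ p * (size t)%:R].
Proof.
move=> D step D0; elim=> [|i t IH] f f' u m d fL f'L.
  by move=> _ _ ud _; exists [::], u; split => //=; rewrite mulr0 addr0.
move=> [fi ft] [f'i f't] ud uN.
rewrite [size _]/= in fL f'L ud uN *; set k := size t in fi f'i ud uN fL f'L *.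
pose z := increment U k f; pose z' := increment U k f'.
(* Both increments have the colour [i], so the difference is close to [Y]; along [F] it is also
   weak-star null. *)
pose v (nm : nat * nat) := z nm.1 - z' nm.2.
pose F := iterated_filter U.
have UF : UltraFilter F by exact: iterated_filter_ultra.
have near_fst (P : nat -> Prop) :
    (\forall n \near U, P n) -> \forall nm \near F, P nm.1.
  by apply: (@filterS _ U) => n Pn; exact: (@filterE _ U).
have near_snd (P : nat -> Prop) :
    (\forall n \near U, P n) -> \forall nm \near F, P nm.2.
  by move=> UP; apply: (@filterE _ U) => n.
have uN' : `|u| <= D * N0.
  by apply: le_trans uN; rewrite lerDl mulr_ge0// ltW.
have lt_near : \forall nm \near F, (m < nm.1)%N /\ (nm.1 < nm.2)%N.
  by apply: (@filterS _ U) (freeU m) => n mn; apply: (@filterS _ U) (freeU n).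
have type_near : \forall nm \near F,
    has_type t (f \o cons nm.1) /\ has_type t (f' \o cons nm.2).
  by apply: filterI; [exact: near_fst ft|exact: near_snd f't].
have v_near : \forall nm \near F, exists y, `|v nm - kappa y| <= 2 * eta.
  apply: filterS2 (near_fst _ fi) (near_snd _ f'i) => nm [y yi] [y' yi'].
  exists (y - y'); rewrite linearB.
  have -> : v nm - (kappa y - kappa y') =
      (z nm.1 - w i - kappa y) - (z' nm.2 - w i - kappa y').
    exact: color_sub.
  by apply: le_trans (ler_normB _ _) _; rewrite /z/z'; lra.
have v_le nm : `|v nm| <= 2 * L.
  apply: le_trans (ler_normB _ _) _.
  have := increment_norm_le ultraU nm.1 fL.
  by have := increment_norm_le ultraU nm.2 f'L; rewrite /z /z'; lra.
have v_cvg0 phi : (v nm phi : R) @[nm --> F] --> (0 : R).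
  rewrite -(subrr (0 : R)).
  apply: (@cvgB _ _ _ F _ (fun nm => z nm.1 phi : R) (fun nm => z' nm.2 phi : R)).
    by move=> A /(increment_cvg0 ultraU phi fL) zA; exact: (near_fst _ zA).
  by move=> A /(increment_cvg0 ultraU phi f'L) zA; exact: (near_snd _ zA).
have step_near := step _ F v u UF uN' v_le v_cvg0 v_near.
have /filter_ex[[a b] /= [[[ma ab] [fta f'tb]] [y [vy yD uy]]]] :
    \forall nm \near F, (((m < nm.1)%N /\ (nm.1 < nm.2)%N) /\
      (has_type t (f \o cons nm.1) /\ has_type t (f' \o cons nm.2))) /\
      exists y, [/\ `|v nm - kappa y| <= 2 * eta, `|y| <= D &
        `|u + y| `^ p <= `|u| `^ p + K * D `^ p].
  by apply: filterI => //; exact: filterI.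
have [||s [x [sk sb xf xp]]] := IH (f \o cons a) (f' \o cons b) (u + y) b
  (d + 2 * eta) (hamming_lipschitz_cons a fL) (hamming_lipschitz_cons b f'L)
  fta f'tb.
- have -> : kappa (u + y) - (iterlim U (size t) (f \o cons a) -
       iterlim U (size t) (f' \o cons b)) =
     (kappa u - (iterlim U k.+1 f - iterlim U k.+1 f')) - (v (a, b) - kappa y).
    rewrite linearD; exact: step_sub.
  by apply: le_trans (ler_normB _ _) _; exact: lerD.
- have := ler_normD u y; move: uN; rewrite -natr1 mulrDr mulr1 -/k; lra.
exists ((a, b) :: s), x; split => //=.
- by rewrite sk.
- by move: xf; rewrite -/k -natr1; lra.
- by move: xp; rewrite -/k -natr1; lra.
Qed.


End Game.

(** * Interlaced tuples with close images *)

Section InterlacedPairs.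
Context {R : realType} {Y : normedModType R}.

Lemma hamming_dist (L : R) k (F : seq nat -> Y) :
  (forall s1 a b s2, size (s1 ++ a :: s2) = k ->
    `|F (s1 ++ a :: s2) - F (s1 ++ b :: s2)| <= L) ->
  forall s0 s s', size (s0 ++ s) = k -> size s' = size s ->
    `|F (s0 ++ s) - F (s0 ++ s')| <= L * (size s)%:R.
Proof.
move=> FL s0 s; elim: s s0 => [|a s IH] s0 [|b s']//.
  by rewrite subrr normr0 mulr0.
move=> sk /= [ss']; apply: le_trans (ler_distD (F (s0 ++ b :: s)) _ _) _.
rewrite -natr1 mulrDr mulr1 addrC; apply: lerD; last exact: FL.
rewrite -!(cat_rcons b); apply: IH => //.
by rewrite -sk !size_cat size_rcons /= addnS.
Qed.

(** The play of [F] against itself: the two iterated limits coincide, so it starts at [u = 0]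
    without error. *)
Theorem quasi_reflexive_AUS_interlaced (p : R) :
  1 < p -> AUS p Y -> quasi_reflexive Y -> exists2 C : R, 0 < C &
  forall (L : R) k (F : seq nat -> Y), 0 < L -> (0 < k)%N ->
    (forall s1 a b s2, size (s1 ++ a :: s2) = k ->
      `|F (s1 ++ a :: s2) - F (s1 ++ b :: s2)| <= L) ->
    exists s, [/\ size s = k, interlaced 0 s &
      `|F (unzip1 s) - F (unzip2 s)| <= C * L * k%:R `^ p^-1].
Proof.
move=> p1 Yp Yqr; have [K K0 KP] := AUS_wnull_step p1 Yp.
have p0 : 0 < p by lra.
exists (3 * (K `^ p^-1 + 1)).
  by rewrite mulr_gt0// ltr_wpDl// powR_ge0.
move=> L k F L0 k0 FL; pose D := 3 * L.
have D0 : 0 < D by rewrite mulr_gt0.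
have kR : 0 < k%:R :> R by rewrite ltr0n.
(* The choice depends on [k]: the error accumulated over [k] rounds must stay at most [D]. *)
have [eta [eta0 eta5 etap etak]] : exists eta, [/\ 0 < eta, 5 * eta <= L,
    3 * eta <= D * k%:R^-1 `^ p & 2 * eta * k%:R <= D].
  have Dk : 0 < D * k%:R^-1 `^ p by rewrite mulr_gt0// powR_gt0// invr_gt0.
  have Dk2 : 0 < D / k%:R by rewrite divr_gt0.
  pose e := Order.min L (Order.min (D * k%:R^-1 `^ p) (D / k%:R)).
  have [eL eDp eD] : [/\ e <= L, e <= D * k%:R^-1 `^ p & e <= D / k%:R].
    by split; rewrite /e !ge_min lexx ?orbT.
  have e0 : 0 < e by rewrite /e !lt_min L0 Dk Dk2.
  exists (e / 5); split; [lra|lra|lra|].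
  by move: eD; rewrite ler_pdivlMr// => eD; have := mulr_gt0 e0 kR; lra.
have [U [ultraU freeU]] := free_ultrafilter.
(* Quasi-reflexivity provides the finitely many colours. *)
have [ws wsP] := ball_net L bidual_subspace Yqr eta0.
pose w (i : 'I_(size ws)) := ws`_i.
pose f s := bidual_embedding (F s).
have fL : hamming_lipschitz k L f.
  split; last by move=> *; rewrite /f -linearB norm_bidual; exact: FL.
  exists (`|F (nseq k 0%N)| + L * k%:R) => s sk; rewrite /f norm_bidual.
  have := @hamming_dist L k F FL [::] s (nseq k 0%N) sk.
  rewrite size_nseq sk => /(_ erefl)/=.
  have := ler_normD (F (nseq k 0%N)) (F s - F (nseq k 0%N)).
  by rewrite subrKC; lra.
have [|t tP] := @exists_type _ _ _ ultraU _ w _ eta _ _ fL.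
  move=> z /wsP[c [_ [cs [y _ <-] zcy]]].
  have ci : (index c ws < size ws)%N by rewrite index_mem.
  by exists (Ordinal ci), y; rewrite /w /= nth_index// ltW.
have sizet : size t = k by rewrite size_tuple.
have [|||||s [x [sk sb xf xp]]] := @interlaced_play _ _ _ ultraU freeU _ w L eta
  p K k%:R _ D0 t f f 0 0 0 _ _ tP tP.
- by move=> T G v u UG uk vL v0 vy; exact: (KP T G v u L k%:R eta).
- by rewrite sizet.
- by rewrite sizet.
- by rewrite linear0 subrr subrr normr0.
- by rewrite sizet normr0 add0r.
exists s; split => //; first by rewrite sk.
have xle : `|x| <= K `^ p^-1 * D * k%:R `^ p^-1.
  move: xp; rewrite normr0 powR0 ?gt_eqF// add0r sizet => xp.
  have -> : `|x| = (`|x| `^ p) `^ p^-1.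
    by rewrite -powRrM divff ?gt_eqF// powRr1.
  apply: (@le_trans _ _ ((K * D `^ p * k%:R) `^ p^-1)).
    apply: ge0_ler_powR => //; rewrite ?nnegrE ?invr_ge0 ?powR_ge0 ?(ltW p0)//.
    by rewrite !mulr_ge0// ?powR_ge0// ltW.
  rewrite powRM ?mulr_ge0 ?powR_ge0 ?(ltW K0)//.
  rewrite powRM ?powR_ge0 ?(ltW K0)//.
  by rewrite -powRrM divff ?gt_eqF// powRr1// ltW.
rewrite -norm_bidual linearB.
have := ler_normB (bidual_embedding x)
  (bidual_embedding x - (f (unzip1 s) - f (unzip2 s))).
rewrite subKr norm_bidual => /le_trans; apply.
(* The error [D] is absorbed in [D * k ^ (1 / p)], whence the [+ 1] in the constant. *)
have k1 : 1 <= k%:R `^ p^-1.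
  rewrite -[leLHS](powRr0 k%:R); apply: ler_powR; first by rewrite ler1n.
  by rewrite invr_ge0 ltW.
have Dk1 : D <= D * k%:R `^ p^-1 by rewrite ler_peMr// ltW.
by move: xf; rewrite add0r sizet /D in etak xle Dk1 *; lra.
Qed.

End InterlacedPairs.

(** * Asymptotic uniform convexity *)

Section AUCSequence.
Context {R : realType} {X : normedModType R}.

Lemma span_consl (n : nat) (e : 'I_n -> X) (w v : X) (a : R) :
  linear_span e (v - a *: w) ->
  linear_span (fun i : 'I_n.+1 => oapp e w (unlift ord0 i)) v.
Proof.
move=> [b _ ev]; exists (fun i => oapp b a (unlift ord0 i)) => //.
rewrite big_ord_recl unlift_none /=.
under eq_bigr do rewrite liftK /=.
by rewrite ev subrKC.
Qed.

(** Enlarging [Z] by a line raises the dimension of its intersection with [W] by at most one: any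
    new vector [w0] accounts for the growth. *)
Lemma infinite_dim_setI (W Z : set X) :
  linear_subspace W -> linear_subspace Z -> finite_codim Z ->
  ~ (exists n (e : 'I_n -> X), W `<=` linear_span e) ->
  ~ (exists n (e : 'I_n -> X), W `&` Z `<=` linear_span e).
Proof.
move=> sW sZ [n [b bZ]]; elim: n b => [|n IH] b in Z sZ bZ * => Winf.
  apply: contra_not Winf => -[m [e WZe]]; exists m, e => w Ww.
  by apply: WZe; split => //; have [_ [a _ <-]] := bZ w; rewrite big_ord0 subr0.
pose Z' := add_line Z (b ord0).
move=> [m [e WZe]].
apply: (IH _ Z' (add_line_subspace _ sZ) (add_line_codim bZ) Winf).
have [W'Z|/existsNP[w0 /not_implyP[[Ww0 [z0 Zz0 [a0 _ w0E]]] nZw0]]] :=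
  pselect (forall w, (W `&` Z') w -> Z w).
  by exists m, e => w [Ww Z'w]; apply: WZe; split => //; exact: W'Z.
have a00 : a0 != 0.
  by apply: contra_notN nZw0 => /eqP a00; rewrite -w0E a00 scale0r addr0.
exists m.+1, (fun i : 'I_m.+1 => oapp e w0 (unlift ord0 i)).
move=> w [Ww [z Zz [a _ wE]]]; apply: (@span_consl _ _ _ _ (a / a0)).
apply: WZe; rewrite -scaleNr addrC; split; first exact: subspaceZD.
have -> : - (a / a0) *: w0 + w = - (a / a0) *: z0 + z.
  rewrite -w0E -wE scalerDr scalerA mulNr divfK//.
  by rewrite addrACA -scalerDl addNr scale0r addr0.
exact: subspaceZD.
Qed.

(** [1 <= |u|] puts [t = 1 / |u|] in the range of AUC. Since [|u| ^ q * t ^ q = 1], the relative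
    gain becomes an additive one independent of [u]. *)
Lemma AUC_step (q : R) : 1 < q -> AUC q X -> exists2 c : R, 0 < c &
  forall u : X, 1 <= `|u| -> exists2 Z, cofinite_subspace Z &
    forall z, Z z -> `|z| = 1 -> `|u| `^ q + c <= `|u + z| `^ q.
Proof.
move=> q1 [c c0 cP]; exists (c / 2); first by rewrite divr_gt0.
move=> u u1; have nu : 0 < `|u| by exact: lt_le_trans u1.
have nu0 : `|u| != 0 by rewrite gt_eqF.
pose x := `|u|^-1 *: u; pose t := `|u|^-1.
have x1 : `|x| = 1 by rewrite normrZ normfV normr_id mulVf.
have t0 : 0 < t by rewrite invr_gt0.
have t1 : t <= 1 by rewrite invf_le1.
have tq0 : 0 < t `^ q by exact: powR_gt0.
have : ((c / 2 * t `^ q)%:E < auc_modulus_at t x)%E.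
  apply: (@lt_le_trans _ _ (auc_modulus (X := X) t)); last first.
    by apply: ereal_inf_lbound; exists x.
  apply: lt_le_trans (cP t _); last by rewrite (ltW t0).
  by rewrite lte_fin; have := mulr_gt0 c0 tq0; lra.
move=> /ereal_sup_gt[_ [Z cZ <-] Zgt]; exists Z => // z Zz z1.
have : c / 2 * t `^ q < `|x + t *: z| - 1.
  by rewrite -lte_fin; apply: lt_le_trans Zgt _; apply: ereal_inf_lbound; exists z.
have -> : x + t *: z = t *: (u + z) by rewrite scalerDr.
rewrite normrZ (gtr0_norm t0) => grow.
have uz : `|u| * (1 + c / 2 * t `^ q) <= `|u + z|.
  by rewrite mulrC -ler_pdivlMr// mulrC; rewrite /t in grow *; lra.
have s0 : 0 <= c / 2 * t `^ q by rewrite mulr_ge0 ?divr_ge0// ltW.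
apply: (@le_trans _ _ ((`|u| * (1 + c / 2 * t `^ q)) `^ q)); last first.
  apply: ge0_ler_powR => //; rewrite ?nnegrE ?mulr_ge0 ?addr_ge0//; lra.
rewrite powRM ?addr_ge0//.
have : 1 + c / 2 * t `^ q <= (1 + c / 2 * t `^ q) `^ q.
  by apply: le1r_powR; lra.
move=> /(ler_wpM2l (powR_ge0 `|u| q)); apply: le_trans.
rewrite mulrDr mulr1 mulrCA -powRM ?(ltW t0)// divff// powR1 mulr1.
exact: lexx.
Qed.

Lemma AUC_extend (q : R) : ~ finite_dim_space X -> 1 < q -> AUC q X ->
  exists2 c : R, 0 < c & forall S : seq X, exists x : X, `|x| = 1 /\
    forall u, u \in S -> u = 0 \/ 1 <= `|u| ->
    forall v, v = u + x \/ v = u - x ->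
      1 <= `|v| /\ `|u| `^ q + c <= `|v| `^ q.
Proof.
move=> Xinf q1 /(AUC_step q1)[c c0 cP].
(* For [u = 0] the gain is exactly [1], whence the minimum. *)
exists (Order.min 1 c) => [|S]; first by rewrite lt_min ltr01.
(* [W] is the intersection of the subspaces attached to the finitely many [u]; both signs of [x] are
   allowed because [W] is symmetric. *)
have [W [sW Winf WP]] : exists W : set X, [/\ linear_subspace W,
    ~ (exists n (e : 'I_n -> X), W `<=` linear_span e) &
    forall u, u \in S -> 1 <= `|u| -> forall z, W z -> `|z| = 1 ->
      `|u| `^ q + c <= `|u + z| `^ q].
  elim: S => [|u S [W [sW Winf WP]]].
    exists setT; split => //.
    by split; [exact/mem_set|move=> a u v _ _; exact/mem_set].
  have [u1|u1] := leP 1 `|u|; last first.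
    exists W; split => // v; rewrite inE => /predU1P[->|]; last exact: WP.
    by rewrite leNgt u1.
  have [Z [sZ _ fZ] ZP] := cP u u1.
  exists (W `&` Z); split; last 2 first.
  - exact: infinite_dim_setI.
  - move=> v; rewrite inE => /predU1P[->|vS] v1 z [Wz Zz] z1; first exact: ZP.
    exact: WP.
  - split; first by apply/mem_set; split; exact: subspace0.
    move=> a x y /set_mem[Wx Zx] /set_mem[Wy Zy].
    by apply/mem_set; split; exact: subspaceZD.
have [x Wx x0] : exists2 x, W x & x != 0.
  apply: contra_notP Winf => noW; exists 0%N, (fun=> 0) => x Wx.
  exists (fun=> 0) => //; rewrite big_ord0; apply/esym/eqP.
  by apply: contra_notT noW => x0; exists x.
have nx : `|x| != 0 by rewrite normr_eq0.
pose y := `|x|^-1 *: x.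
have y1 : `|y| = 1 by rewrite normrZ normfV normr_id mulVf.
have Wy : W y by exact: subspaceZ.
exists y; split => // u uS u01 v vE.
have [u0|u1] := u01.
  have v1 : `|v| = 1.
    by case: vE => ->; rewrite u0 ?add0r ?sub0r ?normrN.
  rewrite v1 u0 normr0 powR0 ?gt_eqF//; last by lra.
  by rewrite powR1 add0r ge_min lexx.
have grow : `|u| `^ q + c <= `|v| `^ q.
  case: vE => ->; first exact: WP.
  by apply: WP; rewrite ?normrN//; exact: subspaceN.
split; last by rewrite (le_trans _ grow)// lerD2l ge_min lexx orbT.
rewrite leNgt; apply/negP => v1.
have : `|v| `^ q <= 1 `^ q.
  by apply: ge0_ler_powR; rewrite ?nnegrE//; [lra|exact: ltW].
have : `|u| <= `|u| `^ q by apply: le1r_powR => //; exact: ltW.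
by rewrite powR1; lra.
Qed.

Theorem AUC_interlaced (q : R) : ~ finite_dim_space X -> 1 < q -> AUC q X ->
  exists c : R, exists x : nat -> X, [/\ 0 < c, forall n, `|x n| = 1 &
    forall s, interlaced 0 s -> c * (size s)%:R <=
      `|\sum_(i <- unzip1 s) x i - \sum_(i <- unzip2 s) x i| `^ q].
Proof.
move=> Xinf q1 /(AUC_extend Xinf q1)[c c0 /choice[g gP]].
(* [S n] holds the combinations of [x 0], ..., [x (n - 1)] with coefficients [-1], [0], [1], and
   [x n] is chosen for it. *)
pose extend S := S ++ [seq u + g S | u <- S] ++ [seq u - g S | u <- S].
pose S n := iter n extend [:: 0]; pose x n := g (S n).
exists c, x; split => // [n|]; first by have [] := gP (S n).
have S_mono m n u : (m <= n)%N -> u \in S m -> u \in S n.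
  move=> /subnK <- uS; elim: (n - m)%N => // k IH.
  by rewrite addSn /S iterS mem_cat IH.
have S_add n u : u \in S n -> u + x n \in S n.+1.
  move=> uS; rewrite /S iterS !mem_cat; apply/or3P/Or32.
  exact: (map_f (fun u => u + g (S n))).
have S_sub n u : u \in S n -> u - x n \in S n.+1.
  move=> uS; rewrite /S iterS !mem_cat; apply/or3P/Or33.
  exact: (map_f (fun u => u - g (S n))).
(* Adding [x a] and subtracting [x b] in increasing order of indices keeps each partial sum in the
   set for which the next vector was chosen. A pair gains [2 * c], of which [c] is kept. *)
suff chain s : forall m u,
    interlaced m s -> u \in S m.+1 -> u = 0 \/ 1 <= `|u| ->
    `|u| `^ q + c * (size s)%:R <=
      `|u + (\sum_(i <- unzip1 s) x i - \sum_(i <- unzip2 s) x i)| `^ q.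
  move=> s sP; have := chain s 0%N 0 sP.
  rewrite add0r normr0 powR0 ?add0r; last first.
    by rewrite gt_eqF//; lra.
  by apply; [apply: (S_mono 0%N) => //; rewrite mem_seq1|left].
elim: s => [|[a b] s IH] m u /=.
  by move=> _ _ _; rewrite !big_nil subrr addr0 mulr0 addr0.
move=> [ma ab sb] uS u01.
have uSa : u \in S a by exact: (S_mono m.+1 a u ma).
have [ua1 ua] := (gP (S a)).2 u uSa u01 (u + x a) (or_introl erefl).
have uaSb : u + x a \in S b by apply: (S_mono a.+1 b _ ab); exact: S_add.
have [ub1 ub] := (gP (S b)).2 (u + x a) uaSb (or_intror ua1) (u + x a - x b)
  (or_intror erefl).
have := IH b (u + x a - x b) sb (S_sub _ _ uaSb) (or_intror ub1).
rewrite !big_cons opprD addrACA !addrA -natr1; lra.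
Qed.

End AUCSequence.

(** * The compression exponent *)

(** If [g < b], dividing by [k ^ g >= 1] leaves [a * k ^ (b - g) <= B + C], false for large [k]. *)
Lemma powR_le_exponent (R : realType) (a B C b g : R) :
  0 < a -> 0 < B -> 0 < C -> 0 <= g ->
  (forall k, (0 < k)%N -> a * k%:R `^ b - C <= B * k%:R `^ g) -> b <= g.
Proof.
move=> a0 B0 C0 g0 le_k; rewrite leNgt; apply/negP => gb.
pose M := (B + C) / a; pose d := b - g.
have d0 : 0 < d by rewrite subr_gt0.
have M0 : 0 < M by rewrite divr_gt0// addr_gt0.
pose k := (Num.truncn (M `^ d^-1)).+1.
have Mk : M `^ d^-1 < k%:R.
  by have /andP[_] := truncn_itv (powR_ge0 M d^-1).
have kR : 0 < k%:R :> R by rewrite ltr0n.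
have : (M `^ d^-1) `^ d < k%:R `^ d.
  by apply: gt0_ltr_powR; rewrite ?nnegrE ?powR_ge0// ltW.
rewrite -powRrM mulVf ?gt_eqF// powRr1 ?(ltW M0)// /M ltr_pdivrMr// mulrC => BCk.
have kg1 : 1 <= k%:R `^ g.
  by rewrite -[leLHS](powRr0 k%:R); apply: ler_powR; rewrite // ler1n.
have := le_k k isT; have -> : b = d + g by rewrite subrK.
rewrite powRD; last by apply/implyP=> _; rewrite gt_eqF.
rewrite mulrA.
have := ltr_pM2r (lt_le_trans ltr01 kg1) (B + C) (a * k%:R `^ d).
rewrite BCk mulrDl; have := ler_wpM2l (ltW C0) kg1; lra.
Qed.

Lemma expansion_modulus_bounded (R : realType) (X Y : normedModType R)
    (f : X -> Y) (t : R) : 0 <= t -> (expansion_modulus f t < +oo)%E ->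
  exists2 L : R, 0 < L & forall x y, `|x - y| <= t -> `|f x - f y| <= L.
Proof.
move=> t0; have ub x y : `|x - y| <= t ->
    (`|f x - f y|%:E <= expansion_modulus f t)%E.
  by move=> xy; apply: ereal_sup_ubound; exists (x, y).
case: expansion_modulus ub => [r ub _|//|ub _].
  exists (Order.max r 1); first by rewrite lt_max ltr01 orbT.
  by move=> x y /ub; rewrite lee_fin le_max => ->.
by have := ub 0 0; rewrite subrr normr0 => /(_ t0).
Qed.

Theorem corollary3p6 (R : realType) (p q : R) (X Y : completeNormedModType R)
  (q_gt1 : 1 < q) (q_lt_p : q < p)
  (X_infinite_dim : ~ finite_dim_space X) (X_AUC : AUC q X)
  (Y_AUS : AUS p Y) (Y_quasi_reflexive : quasi_reflexive Y) :
  compression_exponent X Y <= q / p.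
Proof.
have q0 : 0 < q by lra.
have p0 : 0 < p by lra.
have p1 : 1 < p by lra.
suff ubound_qp alpha : 0 <= alpha < 1 -> (exists f : X -> Y,
    coarse_embedding f /\ exists A C : R, [/\ 0 < A, 0 < C &
      forall t, 0 < t ->
        ((A * t `^ alpha - C)%:E <= compression_modulus f t)%E]) ->
    alpha <= q / p.
  rewrite /compression_exponent; set S := [set _ | _].
  (* The empty set has supremum [0] by default, which satisfies the bound. *)
  have [S0|/set0P/negP] := pselect (S !=set0).
    by apply: ge_sup => // alpha [? ?]; exact: ubound_qp.
  by rewrite negbK => /eqP ->; rewrite sup0 divr_ge0 ?ltW.
move=> /andP[alpha0 _] [f [[_ f_exp] [A [C [A0 C0 f_comp]]]]].
(* Replacing one unit vector by another moves a sum by at most [2]. *)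
have [L L0 fL] := expansion_modulus_bounded (ler0n _ 2) (f_exp 2 (ltr0n _ 2)).
have [c [x [c0 x1 xP]]] := AUC_interlaced X_infinite_dim q_gt1 X_AUC.
have [B B0 BP] := quasi_reflexive_AUS_interlaced p1 Y_AUS Y_quasi_reflexive.
rewrite mulrC -ler_pdivrMr//.
apply: (@powR_le_exponent R (A * c `^ (alpha / q)) (B * L) C) => //.
- by rewrite mulr_gt0// powR_gt0.
- exact: mulr_gt0.
- by rewrite invr_ge0 ltW.
move=> k k0; have kR : 0 < k%:R :> R by rewrite ltr0n.
pose F s := f (\sum_(i <- s) x i).
have [s1 a b s2 _|s [sk sP Fle]] := BP L k F L0 k0.
  apply: fL; rewrite !big_cat !big_cons /= opprD addrACA subrr add0r.
  rewrite opprD addrACA subrr addr0.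
  by apply: le_trans (ler_normB _ _) _; rewrite !x1; lra.
apply: le_trans Fle.
have xs := xP s sP; rewrite sk in xs.
set v := _ - _ in xs.
(* The AUC lower bound on [|v|] gives [t <= |v|], so the compression modulus applies at [t], and
   [t ^ alpha] grows like [k ^ (alpha / q)]. *)
pose t := (c * k%:R) `^ q^-1.
have t0 : 0 < t by rewrite powR_gt0// mulr_gt0.
have tv : t <= `|v|.
  have -> : `|v| = (`|v| `^ q) `^ q^-1.
    by rewrite -powRrM divff ?gt_eqF// powRr1.
  apply: ge0_ler_powR => //; rewrite ?nnegrE ?invr_ge0 ?powR_ge0 ?(ltW q0)//.
  by rewrite mulr_ge0// ltW.
have tF : (compression_modulus f t <= `|F (unzip1 s) - F (unzip2 s)|%:E)%E.
  apply: ereal_inf_lbound.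
  by exists (\sum_(i <- unzip1 s) x i, \sum_(i <- unzip2 s) x i).
have := f_comp t t0; move: tF.
move=> /[swap] /le_trans /[apply]; rewrite lee_fin; apply: le_trans.
rewrite lerD2r /t -powRrM [q^-1 * _]mulrC powRM ?(ltW c0)//.
by rewrite mulrA.
Qed.
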